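(* Let $\mathscr A$ be a prime $C^*$-algebra with unit $I$, and let $\phi:\mathscr A\to\mathscr A$ be a surjective map (linearity not assumed) such that \[ |\phi(A)\phi(B)^*|=|AB^*|\qquad(A,B\in\mathscr A). \] Then there exist a unitary element $U\in\mathscr A$ and a phase-function $\varphi:\mathscr A\to\mathbb C$ such that $\phi(A)=\varphi(A)\,AU$ for all $A\in\mathscr A$.
   Context: A ring $\mathcal R$ is prime if for $a,b\in\mathcal R$, $a\mathcal R b=\{0\}$ implies $a=0$ or $b=0$. For $x$ in a $C^*$-algebra, $|x|=(x^*x)^{1/2}$. A phase-function is a function $\varphi:\mathscr A\to\mathbb C$ with $|\varphi(A)|=1$ for all $A$. *)

(* Defs.v *)
From HB Require Import structures.
From mathcomp Require Import all_boot all_order all_algebra.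
From mathcomp Require Import complex.
From mathcomp Require Import classical_sets reals.
Set Implicit Arguments. Unset Strict Implicit. Unset Printing Implicit Defensive.
Import Order.TTheory GRing.Theory Num.Theory.
Local Open Scope ring_scope.
Local Open Scope complex_scope.

Section CStar.
Variables (R : realType) (A : unitAlgType R[i]) (star : A -> A) (nrm : A -> R).

Record is_unital_Cstar_algebra : Prop := {
  star_add : forall x y, star (x + y) = star x + star y;
  star_scale : forall (c : R[i]) x, star (c *: x) = c^* *: star x;
  star_mul : forall x y, star (x * y) = star y * star x;
  star_invol : forall x, star (star x) = x;
  nrm_ge0 : forall x, 0 <= nrm x;
  nrm_eq0 : forall x, nrm x = 0 -> x = 0;
  nrm_triangle : forall x y, nrm (x + y) <= nrm x + nrm y;
  nrm_scale : forall (c : R[i]) x, (nrm (c *: x))%:C = `|c| * (nrm x)%:C;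
  nrm_submul : forall x y, nrm (x * y) <= nrm x * nrm y;
  nrm_Cstar : forall x, nrm (star x * x) = nrm x ^+ 2;
  nrm_complete : forall u : nat -> A,
    (forall e : R, 0 < e -> exists N, forall m n, (N <= m)%N -> (N <= n)%N ->
        nrm (u m - u n) < e) ->
    exists l, forall e : R, 0 < e -> exists N, forall n, (N <= n)%N ->
        nrm (u n - l) < e
}.

Definition prime_ring : Prop :=
  forall a b : A, (forall x : A, a * x * b = 0) -> a = 0 \/ b = 0.

(* Positive element: self-adjoint with spectrum in [0, +oo), i.e. x - l*1 is
   invertible for every complex l that is not a nonnegative real
   (on R[i], [0 <= l] means l is real and nonnegative). *)
Definition positive (x : A) : Prop :=
  star x = x /\ forall l : R[i], ~~ (0 <= l) -> (x - l *: 1) \is a GRing.unit.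

(* |x| = (x^* x)^{1/2}: the positive square root of x^* x
   (chosen by classical description; it exists and is unique in a C*-algebra). *)
Definition cabs (x : A) : A :=
  xget 0 (fun s : A => positive s /\ s * s = star x * x).

Definition unitary (u : A) : Prop := star u * u = 1 /\ u * star u = 1.

End CStar.

(* Main.v *)
(** Squaring the hypothesis gives phi(Y) phi(X)^* phi(X) phi(Y)^* = Y X^* X Y^*.
    If phi(T) = 1, then T is unitary, and polarisation in X turns this into
    Z a Z^* = Y a Y^* for all a, where Z = phi(Y) T.  In a prime ring this
    implies Z a Y = Y a Z for all a.  Compressing by Y^*, it remains to treat
    self-adjoint h, k with k a h = h a k for all a.  For s < t let p and q be the
    positive parts of s h^2 - k^2 and k^2 - t h^2; comparing the norms of
    k (p a q) h = h (p a q) k with that of h (p a q) h gives h p a q h = 0, so that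
    k^2 >= s h^2 or k^2 <= t h^2.  Hence k^2 is a multiple of h^2; so is (k + h)^2,
    and therefore k is a multiple of h.

    Squaring needs x^* x to have a positive square root.  Positivity is handled
    without spectral theory: a self-adjoint a is the square of a self-adjoint
    element as soon as |r - a| <= r for some real r, because t = (c + t^2) / 2
    is solved by iteration when |c| <= 1. *)
Require Import Defs.
From HB Require Import structures.
From mathcomp Require Import all_boot all_order all_algebra.
From mathcomp Require Import complex.
From mathcomp Require Import classical_sets reals.
From mathcomp Require Import boolp ring lra.
From Stdlib Require Ncring Ncring_tac.
Import Order.TTheory GRing.Theory Num.Theory.
Local Open Scope ring_scope.

Section CStarTheory.
Set Implicit Arguments.
Unset Strict Implicit.
Local Open Scope complex_scope.
Variables (R : realType) (A : unitAlgType R[i]) (star : A -> A) (nrm : A -> R).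
Hypothesis HA : is_unital_Cstar_algebra star nrm.

(** This instance lets [ncring] decide polynomial identities in [A], whose multiplication does not
    commute. *)
#[local] Instance nc_ops : @Ncring.Ring_ops A 0 1 (fun x y => x + y)
  (fun x y => x * y) (fun x y => x - y) (fun x => - x) (@eq A) := {}.

#[local] Instance nc_ring : Ncring.Ring (Ro := nc_ops).
Proof.
split=> /=; try exact _.
- exact: add0r.
- exact: addrC.
- exact: addrA.
- exact: mul1r.
- exact: mulr1.
- exact: mulrA.
- exact: mulrDl.
- by move=> x y z; exact: mulrDr.
- by [].
- exact: subrr.
Qed.

Ltac ncring := Ncring_tac.non_commutative_ring.

(** * Norm, involution and limits *)

Lemma starD x y : star (x + y) = star x + star y.
Proof. exact: (star_add HA). Qed.

Lemma starM x y : star (x * y) = star y * star x.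
Proof. exact: (star_mul HA). Qed.

Lemma starK x : star (star x) = x.
Proof. exact: (star_invol HA). Qed.

Lemma starZ (c : R[i]) x : star (c *: x) = c^*%R *: star x.
Proof. exact: (star_scale HA). Qed.

Lemma starZr (r : R) x : star (r%:C *: x) = r%:C *: star x.
Proof. by rewrite starZ; congr (_ *: _); apply: conj_Creal; rewrite complex_real. Qed.

Lemma star0 : star 0 = 0.
Proof. by rewrite -(scale0r (0 : A)) starZr !scale0r. Qed.

Lemma starN x : star (- x) = - star x.
Proof. by apply/eqP; rewrite -addr_eq0 -starD addNr star0. Qed.

Lemma starB x y : star (x - y) = star x - star y.
Proof. by rewrite starD starN. Qed.

Lemma star1 : star 1 = 1.
Proof. by have := starM (star 1) 1; rewrite mulr1 starK mulr1. Qed.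

Lemma starZi x : star ('i *: x) = - ('i *: star x).
Proof.
rewrite starZ -scaleNr; congr (_ *: _).
by apply/eqP; rewrite eq_complex /= oppr0 !eqxx.
Qed.

Lemma nrmZ (r : R) x : nrm (r%:C *: x) = `|r| * nrm x.
Proof.
apply: complexI; rewrite (nrm_scale HA) rmorphM; congr (_ * _).
by rewrite normc_def /= expr0n /= addr0 sqrtr_sqr.
Qed.

Lemma nrm0 : nrm 0 = 0.
Proof. by rewrite -(scale0r (0 : A)) nrmZ normr0 mul0r. Qed.

Lemma nrmN x : nrm (- x) = nrm x.
Proof.
have -> : - x = (-1)%:C *: x by rewrite rmorphN1 scaleN1r.
by rewrite nrmZ normrN1 mul1r.
Qed.

Lemma nrm_distC x y : nrm (x - y) = nrm (y - x).
Proof. by rewrite -nrmN opprB. Qed.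

Lemma nrm_distD z x y : nrm (x - y) <= nrm (x - z) + nrm (z - y).
Proof. by apply: le_trans (nrm_triangle HA _ _); rewrite addrA subrK. Qed.

(** The C*-identity and submultiplicativity bound [nrm y ^+ 2] by [nrm (star y) * nrm y]; cancel
    [nrm y], then exchange [x] and [star x]. *)
Lemma nrm_star x : nrm (star x) = nrm x.
Proof.
have le_star y : nrm y <= nrm (star y).
  have [->|y0] := eqVneq (nrm y) 0; first exact: (nrm_ge0 HA).
  have y_gt0 : 0 < nrm y by rewrite lt_neqAle eq_sym y0 (nrm_ge0 HA).
  rewrite -(ler_pM2r y_gt0) -expr2 -(nrm_Cstar HA).
  exact: (nrm_submul HA).
by apply/eqP; rewrite eq_le le_star -{2}(starK x) le_star.
Qed.

Lemma nrm_sqr h : star h = h -> nrm (h * h) = nrm h ^+ 2.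
Proof. by move=> sh; rewrite -(nrm_Cstar HA) sh. Qed.

Lemma nrm_Cstarr x : nrm (x * star x) = nrm x ^+ 2.
Proof. by rewrite -{1}(starK x) (nrm_Cstar HA) nrm_star. Qed.

Lemma nrm1 : nrm 1 = 1.
Proof.
have: nrm 1 != 0 by apply/eqP => /(nrm_eq0 HA)/eqP; rewrite oner_eq0.
move=> n1; apply: (mulfI n1); rewrite -expr2 -nrm_sqr ?star1 //.
by rewrite !mulr1.
Qed.

Lemma nrm_scalar (r : R) : 0 <= r -> nrm (r%:C *: 1) = r.
Proof. by move=> r0; rewrite nrmZ nrm1 mulr1 ger0_norm. Qed.

Lemma star_mul_eq0 x : star x * x = 0 -> x = 0.
Proof.
move=> xx; apply: (nrm_eq0 HA); apply/eqP.
by rewrite -sqrf_eq0 -(nrm_Cstar HA) xx nrm0.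
Qed.

Lemma mul_star_eq0 x : x * star x = 0 -> x = 0.
Proof. by rewrite -{1}(starK x) => /star_mul_eq0 /(congr1 star); rewrite starK star0. Qed.

Lemma nrm_small_eq0 x (C : R) : (forall e, 0 < e -> nrm x <= C * e) -> x = 0.
Proof.
move=> H; apply: (nrm_eq0 HA); apply/eqP; rewrite eq_le (nrm_ge0 HA) andbT.
apply/ler_addgt0Pr => e e0; rewrite add0r.
have C0 : 0 < `|C| + 1 by rewrite ltr_wpDl.
apply: le_trans (H _ (divr_gt0 e0 C0)) _.
rewrite mulrCA ger_pMr // ler_pdivrMr // mul1r.
by apply: le_trans (ler_norm _) _; rewrite lerDl.
Qed.

Definition converges_to (u : nat -> A) (l : A) :=
  forall e : R, 0 < e -> exists N, forall n, (N <= n)%N -> nrm (u n - l) < e.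

(** Telescoping bounds [nrm (u m - u n)] by [t m - t n] for [n <= m], and [t] is nondecreasing and
    bounded, so [u] is Cauchy. *)
Lemma dominated_cvg (u : nat -> A) (t : nat -> R) (M : R) :
    (forall n, nrm (u n.+1 - u n) <= t n.+1 - t n) -> (forall n, t n <= M) ->
  exists l, converges_to u l.
Proof.
move=> ut tM.
have utd n k : nrm (u (n + k)%N - u n) <= t (n + k)%N - t n.
  elim: k => [|k IH]; first by rewrite addn0 !subrr nrm0.
  rewrite addnS (le_trans (nrm_distD (u (n + k)%N) _ _)) //.
  by have := ut (n + k)%N; lra.
have utm n m : (n <= m)%N -> nrm (u m - u n) <= t m - t n.
  by move=> nm; rewrite -(subnKC nm).
have tm n m : (n <= m)%N -> t n <= t m.
  by move=> /utm; have := nrm_ge0 HA (u m - u n); lra.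
have hs : has_sup [set x | exists n, x = t n]%classic.
  by split; [exists (t 0%N), 0%N | exists M => _ [n ->]].
apply: (nrm_complete HA) => e e0.
have [_ [N ->] tN] := sup_adherent e0 hs.
have aux m n : (N <= n)%N -> (n <= m)%N -> nrm (u m - u n) < e.
  move=> Nn nm; have := utm _ _ nm; have := tm _ _ Nn.
  have : t m <= sup [set x | exists n, x = t n]%classic.
    by apply: ub_le_sup; [case: hs | exists m].
  by move: tN; lra.
exists N => m n Nm Nn; case/orP: (leq_total n m) => [|mn]; first exact: aux.
by rewrite nrm_distC aux.
Qed.

Lemma neumann x : nrm x < 1 -> 1 - x \is a GRing.unit.
Proof.
move=> x1; have x0 := nrm_ge0 HA x.
(* [u n] is the partial sum of the powers [x ^+ i] with [i < n]; [t n] is the same sum for the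
   number [nrm x]. *)
have [u u0 uS] : exists2 u : nat -> A, u 0%N = 0 & forall n, u n.+1 = 1 + x * u n.
  by exists (fun n => iter n (fun y => 1 + x * y) 0).
have [t t0 tS] : exists2 t : nat -> R,
    t 0%N = 0 & forall n, t n.+1 = 1 + nrm x * t n.
  by exists (fun n => iter n (fun y => 1 + nrm x * y) 0).
have [||l ul] := @dominated_cvg u t (1 - nrm x)^-1.
- elim=> [|n IH]; first by rewrite uS tS u0 t0 !mulr0 !subr0 !addr0 nrm1.
  have -> : u n.+2 - u n.+1 = x * (u n.+1 - u n) by rewrite (uS n.+1) {2}uS; ncring.
  apply: le_trans (nrm_submul HA _ _) _.
  have -> : t n.+2 - t n.+1 = nrm x * (t n.+1 - t n).
    by rewrite (tS n.+1) {2}tS; ring.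
  by rewrite ler_wpM2l.
- have x1' : 0 < 1 - nrm x by rewrite subr_gt0.
  elim=> [|n IH]; first by rewrite t0 invr_ge0 ltW.
  rewrite tS -(ler_pM2r x1') mulVf ?gt_eqF //.
  have: t n * (1 - nrm x) <= 1 by rewrite -ler_pdivlMr // mul1r.
  by nra.
have xu n : x * u n = u n * x.
  elim: n => [|n IH]; first by rewrite u0 mulr0 mul0r.
  by rewrite uS mulrDr mulrDl mulr1 mul1r -mulrA IH.
have xl : x * l = l * x.
  apply/eqP; rewrite -subr_eq0; apply/eqP.
  apply: (@nrm_small_eq0 _ (nrm x + nrm x)) => e /ul[N /(_ _ (leqnn N)) uN].
  have -> : x * l - l * x = (u N - l) * x - x * (u N - l).
    by rewrite mulrBl mulrBr xu; ncring.
  apply: le_trans (nrm_triangle HA _ _) _; rewrite nrmN [leRHS]mulrDl lerD //.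
    by rewrite mulrC; apply: le_trans (nrm_submul HA _ _) _; rewrite ler_wpM2r // ltW.
  by apply: le_trans (nrm_submul HA _ _) _; rewrite ler_wpM2l // ltW.
have l1 : l - x * l = 1.
  apply/eqP; rewrite -subr_eq0; apply/eqP.
  apply: (@nrm_small_eq0 _ (1 + nrm x)) => e /ul[N uN].
  have -> : l - x * l - 1 = x * (u N - l) - (u N.+1 - l).
    by rewrite uS; ncring.
  apply: le_trans (nrm_triangle HA _ _) _; rewrite nrmN addrC [leRHS]mulrDl lerD //.
    by rewrite mul1r ltW // uN.
  by apply: le_trans (nrm_submul HA _ _) _; rewrite ler_wpM2l // ltW // uN.
apply/unitrP; exists l; split.
  by rewrite mulrBr mulr1 -xl.
by rewrite mulrBl mul1r.
Qed.

(** The equation for [t] is the fixed-point equation [t = (c + t ^+ 2) / 2]. Its iteration from 0 is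
    dominated by the scalar iteration with [c = 1], which stays in [0, 1]; this covers the boundary
    case [nrm c = 1]. *)
Lemma sqrt_one_sub c : star c = c -> nrm c <= 1 ->
  exists t, [/\ star t = t, nrm t <= 1, (1 - t) * (1 - t) = 1 - c
              & forall b, b * c = c * b -> b * t = t * b].
Proof.
move=> sc c1.
have [u u0 uS] : exists2 u : nat -> A,
    u 0%N = 0 & forall n, u n.+1 = (2^-1 : R)%:C *: (c + u n * u n).
  by exists (fun n => iter n (fun y => (2^-1 : R)%:C *: (c + y * y)) 0).
have [t t0 tS] : exists2 t : nat -> R,
    t 0%N = 0 & forall n, t n.+1 = (1 + t n * t n) / 2.
  by exists (fun n => iter n (fun y => (1 + y * y) / 2) 0).
have nrm2 x : nrm ((2^-1 : R)%:C *: x) = nrm x / 2.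
  by rewrite nrmZ ger0_norm ?invr_ge0 // mulrC.
have t01 n : 0 <= t n <= 1 by elim: n => [|n /andP[]]; rewrite ?t0 ?tS; nra.
have ut n : nrm (u n) <= t n.
  elim: n => [|n IH]; first by rewrite u0 t0 nrm0.
  rewrite uS tS nrm2 ler_pM2r ?invr_gt0 //.
  apply: le_trans (nrm_triangle HA _ _) _; rewrite lerD //.
  by apply: le_trans (nrm_submul HA _ _) _; rewrite ler_pM ?(nrm_ge0 HA).
have [||l ul] := @dominated_cvg u t 1.
- elim=> [|n IH]; first by have := ut 1%N; rewrite u0 t0 !subr0.
  (* The difference of squares is split without commuting the iterates; the scalar sequence obeys
     the same identity. *)
  have -> : u n.+2 - u n.+1 =
      (2^-1 : R)%:C *: ((u n.+1 - u n) * u n.+1 + u n * (u n.+1 - u n)).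
    rewrite (uS n.+1) [X in _ - X = _]uS -scalerBr.
    by congr (_ *: _); ncring.
  rewrite nrm2.
  have -> : t n.+2 - t n.+1 = ((t n.+1 - t n) * t n.+1 + t n * (t n.+1 - t n)) / 2.
    by rewrite (tS n.+1) [X in _ - X = _]tS; field.
  rewrite ler_pM2r ?invr_gt0 //; apply: le_trans (nrm_triangle HA _ _) _.
  by rewrite lerD //; apply: le_trans (nrm_submul HA _ _) _;
    rewrite ler_pM ?(nrm_ge0 HA).
- by move=> n; case/andP: (t01 n).
have u1 n : nrm (u n) <= 1 by apply: le_trans (ut n) _; case/andP: (t01 n).
have l1 : nrm l <= 1.
  apply/ler_addgt0Pr => e /ul[N /(_ _ (leqnn N)) uN].
  have := nrm_distD (u N) l 0; rewrite !subr0 => /le_trans; apply.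
  by rewrite nrm_distC addrC lerD // ltW.
exists l; split=> //.
- have su n : star (u n) = u n.
    by elim: n => [|n IH]; rewrite ?u0 ?star0 // uS starZr starD sc starM IH.
  apply/eqP; rewrite -subr_eq0; apply/eqP.
  apply: (@nrm_small_eq0 _ 2) => e /ul[N /(_ _ (leqnn N)) uN].
  apply: le_trans (nrm_distD (u N) _ _) _.
  by rewrite -{1}su -starB nrm_star nrm_distC; move: uN; lra.
- have : l + l = c + l * l.
    apply/eqP; rewrite -subr_eq0; apply/eqP.
    (* The 4 counts two errors at [N.+1] and two at [N], the latter with factors [u N] and [l] of
       norm at most 1. *)
    apply: (@nrm_small_eq0 _ 4) => e /ul[N uN].
    have uN2 : u N.+1 + u N.+1 = c + u N * u N.
      by rewrite uS -scalerDl -rmorphD /= -div1r -splitr scale1r.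
    have -> : l + l - (c + l * l) =
        - (u N.+1 - l) - (u N.+1 - l) + ((u N - l) * u N + l * (u N - l)).
      rewrite -[c](addrK (u N * u N)) -uN2; ncring.
    have := uN _ (leqnSn _); have := uN _ (leqnn _) => uN0 uN1.
    apply: le_trans (nrm_triangle HA _ _) _.
    apply: le_trans (lerD (nrm_triangle HA _ _) (nrm_triangle HA _ _)) _.
    rewrite !nrmN.
    have := nrm_submul HA (u N - l) (u N); have := nrm_submul HA l (u N - l).
    have := u1 N; have := nrm_ge0 HA (u N - l); nra.
  move=> ll; rewrite -[c](addrK (l * l)) -ll; ncring.
- move=> b bc; have bu n : b * u n = u n * b.
    elim: n => [|n IH]; first by rewrite u0 mulr0 mul0r.
    rewrite uS -scalerAr -scalerAl; congr (_ *: _).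
    by rewrite mulrDr mulrDl bc mulrA IH -mulrA IH mulrA.
  apply/eqP; rewrite -subr_eq0; apply/eqP.
  apply: (@nrm_small_eq0 _ (nrm b + nrm b)) => e /ul[N /(_ _ (leqnn N)) uN].
  have -> : b * l - l * b = (u N - l) * b - b * (u N - l).
    by rewrite mulrBl mulrBr bu; ncring.
  apply: le_trans (nrm_triangle HA _ _) _; rewrite nrmN [leRHS]mulrDl lerD //.
    by rewrite mulrC; apply: le_trans (nrm_submul HA _ _) _;
      rewrite ler_wpM2r ?(nrm_ge0 HA) // ltW.
  by apply: le_trans (nrm_submul HA _ _) _; rewrite ler_wpM2l ?(nrm_ge0 HA) // ltW.
Qed.

(** * Squares of self-adjoint elements *)

Definition sc (r : R) : A := r%:C *: 1.

Lemma sc0 : sc 0 = 0.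
Proof. exact: scale0r. Qed.

Lemma scD (r s : R) : sc (r + s) = sc r + sc s.
Proof. by rewrite /sc rmorphD scalerDl. Qed.

Lemma sc_half (x : A) : (2^-1 : R)%:C *: (x + x) = x.
Proof. by rewrite scalerDr -scalerDl -rmorphD -div1r -splitr scale1r. Qed.

Lemma addrr_inj (x y : A) : x + x = y + y -> x = y.
Proof. by move=> xy; rewrite -(sc_half x) xy sc_half. Qed.

Lemma scaleii (x : A) : 'i *: ('i *: x) = - x.
Proof. by rewrite scalerA -expr2 sqr_i scaleN1r. Qed.

Lemma mulZi (x y : A) : ('i *: x) * ('i *: y) = - (x * y).
Proof. by rewrite -scalerAl -scalerAr scaleii. Qed.

Lemma star_sc (r : R) : star (sc r) = sc r.
Proof. by rewrite /sc starZr star1. Qed.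

Lemma mul_sc (r : R) (x : A) : sc r * x = r%:C *: x.
Proof. by rewrite /sc -scalerAl mul1r. Qed.

Lemma mul_scr (r : R) (x : A) : x * sc r = r%:C *: x.
Proof. by rewrite /sc -scalerAr mulr1. Qed.

(** A notion of positivity without spectra: [near_psd] and [psd_near] tie it to a norm estimate, and
    [psd_positive] leads to the spectral definition. *)
Definition psd a := exists2 h, star h = h & h * h = a.

Lemma psd_sa a : psd a -> star a = a.
Proof. by case=> h sh <-; rewrite starM sh. Qed.

Lemma psd_sq h : star h = h -> psd (h * h).
Proof. by move=> sh; exists h. Qed.

Lemma psdZ (r : R) a : 0 <= r -> psd a -> psd (r%:C *: a).
Proof.
move=> r0 [h sh <-]; exists ((Num.sqrt r)%:C *: h); first by rewrite starZr sh.
by rewrite -scalerAl -scalerAr scalerA -rmorphM -expr2 sqr_sqrtr.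
Qed.

(** Apply [sqrt_one_sub] to [(r - a) / r]. The third clause puts the root itself within reach of
    [near_psd], so the root is again positive. *)
Lemma sqrt_near a (r : R) : star a = a -> nrm (sc r - a) <= r ->
  exists h, [/\ star h = h, h * h = a, nrm (sc (Num.sqrt r) - h) <= Num.sqrt r
              & forall b, b * a = a * b -> b * h = h * b].
Proof.
move=> sa na; have r0 : 0 <= r by apply: le_trans na; apply: (nrm_ge0 HA).
have [r00|r_neq0] := eqVneq r 0.
  have a0 : a = 0.
    apply: (nrm_eq0 HA); apply/eqP; rewrite eq_le (nrm_ge0 HA) andbT.
    by move: na; rewrite r00 sc0 sub0r nrmN.
  exists 0; rewrite a0 r00 sqrtr0 sc0 subrr nrm0 star0 mulr0; split=> //.
have rK x : r%:C *: (r^-1%:C *: x) = x.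
  by rewrite scalerA -rmorphM mulfV // scale1r.
have [||t [st t1 tt tc]] := @sqrt_one_sub (r^-1%:C *: (sc r - a)).
- by rewrite starZr starB star_sc sa.
- rewrite nrmZ ger0_norm ?invr_ge0 // mulrC ler_pdivrMr ?mul1r //.
  by rewrite lt_neqAle eq_sym r_neq0.
exists ((Num.sqrt r)%:C *: (1 - t)); split.
- by rewrite starZr starB star1 st.
- rewrite -scalerAl -scalerAr scalerA -rmorphM -expr2 sqr_sqrtr // tt.
  by rewrite scalerBr rK subKr.
- rewrite -scalerBr subKr nrmZ ger0_norm ?sqrtr_ge0 //.
  by rewrite ler_piMr ?sqrtr_ge0.
- move=> b ba; rewrite -scalerAr -scalerAl mulrBr mulrBl mulr1 mul1r tc //.
  by rewrite -scalerAr -scalerAl mulrBr mulrBl mul_sc mul_scr ba.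
Qed.

Lemma near_psd a (r : R) : star a = a -> nrm (sc r - a) <= r -> psd a.
Proof. by move=> sa /(sqrt_near sa)[h [sh hh _ _]]; exists h. Qed.

(* [h + i v] is [Num.sqrt r] times a unitary, and [h] is its real part. *)
Lemma nrm_sum_sq h v (r : R) : 0 <= r -> star h = h -> star v = v ->
  h * v = v * h -> h * h + v * v = sc r -> nrm (h * h) <= r.
Proof.
move=> r0 sh sv hv hhvv; set w := h + 'i *: v.
have sw : star w = h - 'i *: v by rewrite starD starZi sh sv.
have nw : nrm w ^+ 2 = r.
  rewrite -(nrm_Cstar HA) sw /w mulrDr !mulrBl mulZi -scalerAl -scalerAr hv.
  by rewrite opprK addrA subrK hhvv nrm_scalar.
have nh : nrm h <= nrm w.
  have -> : h = (2^-1 : R)%:C *: (w + star w).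
    by rewrite sw /w addrACA subrr addr0 sc_half.
  rewrite nrmZ ger0_norm ?invr_ge0 // mulrC ler_pdivrMr //.
  by apply: le_trans (nrm_triangle HA _ _) _; rewrite nrm_star mulr_natr mulr2n.
by rewrite nrm_sqr // -nw lerXn2r ?nnegrE ?(nrm_ge0 HA).
Qed.

(** With [a = h * h], the element [r - a] has a root [v] commuting with [h], and [nrm_sum_sq] bounds
    [v * v = r - a]. *)
Lemma psd_near a (r : R) : psd a -> nrm a <= r -> nrm (sc r - a) <= r.
Proof.
case=> h sh <- hr; have r0 : 0 <= r by apply: le_trans hr; apply: (nrm_ge0 HA).
have s : star (sc r - h * h) = sc r - h * h by rewrite starB star_sc starM sh.
have [|v [sv vv _ vc]] := sqrt_near (r := r) s; first by rewrite subKr.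
rewrite -vv; apply: (@nrm_sum_sq v h) => //; last by rewrite vv subrK.
by apply/esym/vc; rewrite mulrBr mulrBl mul_sc mul_scr mulrA.
Qed.

Lemma psd_sqrt a : psd a -> exists h,
  [/\ psd h, h * h = a & forall b, b * a = a * b -> b * h = h * b].
Proof.
move=> pa; have [h [sh hh hr hc]] := sqrt_near (psd_sa pa) (psd_near pa (lexx _)).
by exists h; split=> //; exact: near_psd hr.
Qed.

(** In the form of the norm estimate positivity is additive: the radii [nrm a] and [nrm b] add
    up. *)
Lemma psdD a b : psd a -> psd b -> psd (a + b).
Proof.
move=> pa pb; apply: (@near_psd _ (nrm a + nrm b)).
  by rewrite starD !psd_sa.
rewrite scD opprD addrACA.
by apply: le_trans (nrm_triangle HA _ _) _; rewrite lerD // psd_near.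
Qed.

Lemma psd_half a : psd (a + a) -> psd a.
Proof. by move=> p; rewrite -(sc_half a); apply: psdZ; rewrite ?invr_ge0. Qed.

Lemma nrm_le_of_psd u (r : R) : 0 <= r -> psd u -> psd (sc r - u) -> nrm u <= r.
Proof.
move=> r0 pu /psd_sqrt[v [/psd_sa sv vv vc]]; case: pu vv vc => h sh <- vv vc.
apply: (@nrm_sum_sq h v) => //; last by rewrite vv addrC subrK.
by apply: vc; rewrite mulrBr mulrBl mul_sc mul_scr mulrA.
Qed.

Lemma psd_anti a : psd a -> psd (- a) -> a = 0.
Proof.
move=> pa pNa; apply: (nrm_eq0 HA); apply/eqP.
rewrite eq_le (nrm_ge0 HA) andbT; apply: nrm_le_of_psd => //.
by rewrite sc0 sub0r.
Qed.

(** [nrm v - u] is the sum of the positive elements [nrm v - v] and [v - u]. *)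
Lemma nrm_mono u v : psd u -> psd (v - u) -> nrm u <= nrm v.
Proof.
move=> pu pvu; have sv : star v = v.
  by rewrite -(subrK u v) starD !psd_sa.
apply: nrm_le_of_psd => //; first exact: (nrm_ge0 HA).
rewrite -(subrK v (sc _)) -addrA; apply: psdD => //.
apply: (@near_psd _ (nrm v)); first by rewrite starB star_sc sv.
by rewrite subKr.
Qed.

Lemma psd_closed b c : star b = b ->
  (forall e : R, 0 < e -> psd (b + e%:C *: c)) -> psd b.
Proof.
move=> sb bc; have b0 := nrm_ge0 HA b; have c0 := nrm_ge0 HA c.
pose r := nrm b + nrm c; apply: (@near_psd _ r) => //.
apply/ler_addgt0Pr => d d0.
(* [e <= 1] makes the radius [r] valid for [b + e c], and [e * nrm c <= d] bounds the error of
   dropping [e c]. *)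
pose e := Num.min 1 (d / (nrm c + 1)).
have e0 : 0 < e by rewrite lt_min ltr01 divr_gt0 // ltr_wpDl.
have e1 : e <= 1 by rewrite ge_min lexx.
have ed : e * nrm c <= d.
  have : e * (nrm c + 1) <= d by rewrite -ler_pdivlMr ?ltr_wpDl // ge_min lexx orbT.
  by nra.
have ne : nrm (e%:C *: c) = e * nrm c by rewrite nrmZ gtr0_norm.
have -> : sc r - b = sc r - (b + e%:C *: c) + e%:C *: c by rewrite opprD addrA subrK.
apply: le_trans (nrm_triangle HA _ _) _; rewrite ne lerD //.
apply: psd_near; first exact: bc.
by apply: le_trans (nrm_triangle HA _ _) _; rewrite ne lerD // ler_piMl.
Qed.
(* Passing from [star y * y] to [y * star y] replaces the spectral argument:
   [star y * (c - y * star y) * y = - (c u + u^2)], so with [c = nrm u] the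
   right-hand side has norm at most [c^2], although it dominates [2 u^2]. *)
Lemma psd_opp_star_mul y : psd (- (star y * y)) -> psd (y * star y) -> y = 0.
Proof.
move=> pu pb; set u := - (star y * y) in pu; pose c := nrm u.
have cE : c = nrm y ^+ 2 by rewrite /c nrmN (nrm_Cstar HA).
have c0 : 0 <= c by exact: (nrm_ge0 HA).
have su := psd_sa pu.
have le_cc : nrm (c%:C *: u + u * u) <= c * c.
  have -> : c%:C *: u + u * u = - (star y * (sc c - y * star y) * y).
    rewrite mulrBr mulrBl mul_scr -scalerAl -[star y * y]opprK -/u.
    have -> : star y * (y * star y) * y = u * u by rewrite mulrNN !mulrA.
    by rewrite scalerN opprB opprK addrC.
  rewrite nrmN; apply: le_trans (nrm_submul HA _ _) _.
  have le_y : nrm (star y * (sc c - y * star y)) <= nrm y * c.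
    apply: le_trans (nrm_submul HA _ _) _; rewrite nrm_star ler_wpM2l ?(nrm_ge0 HA) //.
    by apply: psd_near => //; rewrite nrm_Cstarr cE.
  apply: le_trans (ler_wpM2r (nrm_ge0 HA y) le_y) _.
  by rewrite mulrAC -expr2 -cE.
have psd_cu : psd (c%:C *: u - u * u).
  have [|v [pv vv vc]] := @psd_sqrt (sc c - u).
    by apply: (@near_psd _ c); rewrite ?starB ?star_sc ?su ?subKr.
  case: pu => h sh hh.
  have hv : h * v = v * h.
    by apply: vc; rewrite mulrBr mulrBl mul_sc mul_scr -hh mulrA.
  exists (h * v); first by rewrite starM sh (psd_sa pv) hv.
  by rewrite mulrA -(mulrA h) -hv !mulrA hh -mulrA vv mulrBr mul_scr.
have H : nrm (u * u + u * u) <= c * c.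
  apply: le_trans le_cc; apply: nrm_mono; first by apply: psdD; exact: psd_sq.
  by rewrite opprD addrA addrK.
have uu : nrm (u * u + u * u) = 2 * (c * c).
  have -> : u * u + u * u = (2 : R)%:C *: (u * u).
    by rewrite rmorph_nat scaler_nat mulr2n.
  by rewrite nrmZ ger0_norm // nrm_sqr // expr2.
have /eqP : c = 0 by rewrite uu in H; nra.
by rewrite cE sqrf_eq0 => /eqP /(nrm_eq0 HA).
Qed.

Lemma psd_star_mul_sum y : psd (y * star y + star y * y).
Proof.
apply: psd_half; set k := 'i *: (y - star y).
have sk : star k = k by rewrite /k starZi starB starK -scalerN opprB.
have -> : y * star y + star y * y + (y * star y + star y * y) =
    (y + star y) * (y + star y) + k * k.
  by rewrite mulZi; ncring.
by apply: psdD; apply: psd_sq; rewrite // starD starK addrC.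
Qed.

(** Let [e] be the root of [a * a] and [q = e - a], twice the negative part of [a]. Then
    [star (y * q) * (y * q) = - (q * e * q)] is negative, which forces [y * q = 0], hence [q = 0]
    and [a = e]. *)
Lemma psd_star_mul y : psd (star y * y).
Proof.
set a := star y * y; have sa : star a = a by rewrite starM starK.
have [e [pe ee ec]] := psd_sqrt (psd_sq sa).
have ea : a * e = e * a by apply: ec; rewrite mulrA.
(* The root [r] of [e] commutes with [q], so that [q * e * q] is the square of the self-adjoint
   [r * q]. *)
have [r [/psd_sa sr rr rc]] := psd_sqrt pe.
pose q := e - a; have sq : star q = q by rewrite starB (psd_sa pe) sa.
have aq : a * q = - (e * q) by rewrite !mulrBr ee ea opprB.
have rq : r * q = q * r by rewrite -rc // mulrBr mulrBl ea.
have qeq : q * e * q = (r * q) * (r * q) by rewrite {1}rq mulrA -(mulrA q r r) rr.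
have yq0 : y * q = 0.
  have xx : star (y * q) * (y * q) = - ((r * q) * (r * q)).
    by rewrite starM sq -qeq -!mulrA [star y * _]mulrA -/a aq mulrN.
  have pqe : psd ((r * q) * (r * q)) by apply: psd_sq; rewrite starM sr sq rq.
  apply: psd_opp_star_mul; rewrite ?xx ?opprK //.
  by rewrite -[X in psd X](addrK (star (y * q) * (y * q))) xx opprK; apply: psdD => //;
    rewrite -xx; exact: psd_star_mul_sum.
have q0 : q = 0.
  have qq0 : q * (a * q) = 0 by rewrite /a -!mulrA yq0 !mulr0.
  have qq : q * q = e * q + e * q by rewrite {1}/q mulrBl aq opprK.
  have q3 : q * (q * q) = 0.
    by rewrite qq mulrDr -[e * q]opprK -aq mulrN qq0 oppr0 addr0.
  apply: star_mul_eq0; rewrite sq; apply: star_mul_eq0.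
  by rewrite starM sq -mulrA q3 mulr0.
by rewrite -/a -[a](subKr e) -/q q0 subr0.
Qed.

Lemma psd_conj a y : psd a -> psd (star y * a * y).
Proof.
by case=> h sh <-; rewrite mulrA -mulrA -{1}sh -starM; exact: psd_star_mul.
Qed.

(** * Spectral positivity and the absolute value *)

Lemma add_sqr_unit h (b : R) : star h = h -> 0 < b -> h * h + sc b \is a GRing.unit.
Proof.
move=> sh b0; have c0 := nrm_ge0 HA (h * h).
(* Scaling by [T] turns the element into [1 - x] with [nrm x <= nrm (h * h) / T < 1], a case for
   [neumann]. *)
pose T := b + nrm (h * h); have T0 : 0 < T by rewrite ltr_pwDl.
pose x := T^-1%:C *: (sc (nrm (h * h)) - h * h).
have -> : h * h + sc b = T%:C *: (1 - x).
  rewrite scalerBr /x scalerA -rmorphM mulfV ?gt_eqF // scale1r.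
  by rewrite -/(sc T) scD; ncring.
have xu : 1 - x \is a GRing.unit.
  apply: neumann; rewrite /x nrmZ ger0_norm ?invr_ge0 ?ltW // mulrC.
  rewrite ltr_pdivrMr // mul1r; apply: le_lt_trans (_ : nrm (h * h) < T).
    by apply: psd_near => //; exact: psd_sq.
  by rewrite ltrDr.
rewrite scaler_unit // unitfE; apply/eqP => /complexI/eqP; by rewrite gt_eqF.
Qed.

(** With [h' = h - Re m] and [b = i Im m], the commuting factors [h' - b] and [h' + b] have the
    invertible product [h' * h' + (Im m) ^+ 2]. *)
Lemma sub_nonreal_unit h (m : R[i]) : star h = h -> complex.Im m != 0 ->
  h - m *: 1 \is a GRing.unit.
Proof.
move=> sh m0; pose h' := h - sc (complex.Re m); pose b := 'i *: sc (complex.Im m).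
have sh' : star h' = h' by rewrite starB sh star_sc.
have -> : h - m *: 1 = h' - b.
  rewrite {1}(complexE m) scalerDl opprD addrA; congr (_ - _).
  by rewrite /b /sc scalerA.
have hb : h' * b = b * h'.
  by rewrite -scalerAl -scalerAr mul_sc mul_scr.
have bb : b * b = - sc (complex.Im m ^+ 2).
  by rewrite mulZi mul_sc /sc scalerA -rmorphM expr2.
clearbody h' b.
have : (h' - b) * (h' + b) \is a GRing.unit.
  have -> : (h' - b) * (h' + b) = h' * h' + sc (complex.Im m ^+ 2).
    by rewrite mulrDr !mulrBl bb hb opprK addrA subrK.
  by apply: add_sqr_unit => //; rewrite exprn_even_gt0.
rewrite unitrM_comm ?andbP; first by case/andP.
rewrite /GRing.comm.
have -> : (h' + b) * (h' - b) = h' * h' - h' * b + b * h' - b * b by ncring.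
by rewrite hb mulrDr !mulrBl hb; ncring.
Qed.

Lemma psd_positive s : psd s -> positive star s.
Proof.
move=> ps; split; first exact: psd_sa.
(* Since [l] is not a nonnegative real, its root [m] is not real, and [h * h - l] factors as
   [(h - m) * (h + m)]. *)
case: ps => h sh <- l l0; pose m := sqrtc l.
have mm : m * m = l by rewrite -expr2 sqr_sqrtc.
have m0 : complex.Im m != 0.
  apply: contra l0 => /eqP m0; rewrite -mm.
  have -> : m = (complex.Re m)%:C by rewrite {1}(complexE m) m0 mulr0 addr0.
  by rewrite -rmorphM ler0c -expr2 sqr_ge0.
have -> : h * h - l *: 1 = (h - m *: 1) * (h - (- m) *: 1).
  rewrite scaleNr opprK; have hM : h * (m *: 1) = m *: 1 * h.
    by rewrite -scalerAl -scalerAr mulr1 mul1r.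
  have -> : l *: 1 = (m *: 1) * (m *: 1) :> A by rewrite -scalerAl mul1r scalerA mm.
  by rewrite mulrDr !mulrBl hM addrA subrK.
by rewrite unitrMl sub_nonreal_unit // raddfN oppr_eq0.
Qed.

Lemma cabs_sqr x : cabs star x * cabs star x = star x * x.
Proof.
have [s [/psd_positive ps ss _]] := psd_sqrt (psd_star_mul x).
(* The witness [s] excludes the default value 0 of [xget]. *)
rewrite /cabs; case: xgetP => [y _ [] //|/(_ s) []]; by split.
Qed.

(** * Proportional elements of a prime C*-algebra *)

Lemma pos_part D : star D = D ->
  exists p, [/\ star p = p, psd (p * D * p) & D * p = 0 -> psd (- D)].
Proof.
move=> sD; have [e [pe ee ec]] := psd_sqrt (psd_sq sD).
have De : D * e = e * D by apply: ec; rewrite mulrA.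
(* [p] is twice the positive part of [D]; [D * p = e * p] because [D * D = e * e]. *)
have se := psd_sa pe; pose p := e + D.
have Dp : D * p = e * p by rewrite !mulrDr De ee addrC.
have sp : star p = p by rewrite starD se sD.
exists p; split=> //.
  by rewrite -mulrA Dp mulrA -{1}sp; exact: psd_conj.
move=> Dp0; suff p0 : p = 0 by move: pe; rewrite -[e](addrK D) -/p p0 sub0r.
by apply: star_mul_eq0; rewrite sp {1}/p mulrDl -Dp Dp0 addr0.
Qed.

Section Prime.
Hypothesis Aprime : prime_ring A.

Lemma prime_eq0 (a b : A) : a <> 0 -> (forall x, a * x * b = 0) -> b = 0.
Proof. by move=> a0 /Aprime[]. Qed.

Section SelfAdjointPair.
Variables h k : A.
Hypotheses (sh : star h = h) (sk : star k = k) (h0 : h <> 0).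
Hypothesis khhk : forall a, k * a * h = h * a * k.

Let mul_left_eq0 p : h * p = 0 -> k * p = 0.
Proof.
move=> hp; apply: (prime_eq0 h0) => b.
by rewrite mulrA -khhk -mulrA hp mulr0.
Qed.

Lemma sqr_dichotomy (s t : R) : 0 <= s -> s < t ->
  psd (k * k - s%:C *: (h * h)) \/ psd (t%:C *: (h * h) - k * k).
Proof.
move=> s0 st.
have sa2 (r : R) : star (r%:C *: (h * h) - k * k) = r%:C *: (h * h) - k * k.
  by rewrite starB starZr !starM sh sk.
have [p [sp pp pN]] := pos_part (sa2 s).
have sa2N : star (k * k - t%:C *: (h * h)) = k * k - t%:C *: (h * h).
  by rewrite -opprB starN sa2.
have [q [sq qq qN]] := pos_part sa2N.
have paq a : h * p * a * (q * h) = 0.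
  (* Reading [w] as [k * x * h] puts [p] next to [k * k] in [star w * w]; reading it as [h * x * k]
     puts [q] next to [k * k] in [w * star w]. The two bounds give
     [t * nrm v ^+ 2 <= s * nrm v ^+ 2], so [v = 0]. *)
  pose x := p * a * q; pose v := h * x * h; pose w := k * x * h.
  have w2 : w = h * x * k by exact: khhk.
  have le_w : nrm w ^+ 2 <= s * nrm v ^+ 2.
    rewrite -!(nrm_Cstar HA) -{1}(ger0_norm s0) -nrmZ; apply: nrm_mono.
      exact: psd_star_mul.
    have -> : s%:C *: (star v * v) - star w * w =
        star (a * q * h) * (p * (s%:C *: (h * h) - k * k) * p) * (a * q * h).
      rewrite /v /w /x !starM sh sk sp sq.
      rewrite mulrBr !mulrBl mulrBr mulrBl.
      by rewrite -!(scalerAl, scalerAr) !mulrA.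
    exact: psd_conj.
  have le_v : t * nrm v ^+ 2 <= nrm w ^+ 2.
    have t0 : 0 <= t by apply: ltW; apply: le_lt_trans st.
    rewrite -!nrm_Cstarr -{1}(ger0_norm t0) -nrmZ; apply: nrm_mono.
      by apply: psdZ => //; rewrite -{1}(starK v); exact: psd_star_mul.
    have -> : w * star w - t%:C *: (v * star v) =
        star (star (h * p * a)) * (q * (k * k - t%:C *: (h * h)) * q) * star (h * p * a).
      rewrite w2 /v /x starK !starM sh sk sp sq.
      rewrite mulrBr !mulrBl mulrBr mulrBl.
      by rewrite -!(scalerAl, scalerAr) !mulrA.
    exact: psd_conj.
  have -> : h * p * a * (q * h) = v by rewrite /v /x !mulrA.
  apply: (nrm_eq0 HA); apply/eqP; rewrite -sqrf_eq0 eq_le sqr_ge0 andbT.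
  by move: le_w le_v st; have := sqr_ge0 (nrm v); nra.
case: (Aprime paq) => [hp|qh].
  left; rewrite -opprB; apply: pN.
  by rewrite mulrBl -scalerAl -!mulrA hp (mul_left_eq0 hp) !mulr0 scaler0 subr0.
right; rewrite -opprB; apply: qN.
have hq : h * q = 0 by rewrite -sh -sq -starM qh star0.
by rewrite mulrBl -scalerAl -!mulrA hq (mul_left_eq0 hq) !mulr0 scaler0 subr0.
Qed.

(** Take for [m] the supremum of the [s] with [s h^2 <= k^2]; both inequalities between [k^2] and
    [m h^2] are limits, obtained from [psd_closed]. *)
Lemma sqr_proportional : exists m : R, k * k = m%:C *: (h * h).
Proof.
pose S := [set s : R | 0 <= s /\ psd (k * k - s%:C *: (h * h))]%classic.
have S0 : S 0 by split; rewrite // scale0r subr0; exact: psd_sq.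
have hh0 : 0 < nrm (h * h).
  rewrite lt_neqAle (nrm_ge0 HA) andbT eq_sym; apply/eqP => /(nrm_eq0 HA) hh.
  by apply: h0; apply: star_mul_eq0; rewrite sh.
have hs : has_sup S.
  split; first by exists 0.
  exists (nrm (k * k) / nrm (h * h)) => s [s0 ps].
  rewrite ler_pdivlMr // -{1}(ger0_norm s0) -nrmZ.
  by apply: nrm_mono => //; apply: psdZ => //; exact: psd_sq.
pose m := sup S; have m0 : 0 <= m by apply: ub_le_sup => //; case: hs.
have saZ (r : R) : star (r%:C *: (h * h)) = r%:C *: (h * h) by rewrite starZr starM sh.
have skk : star (k * k) = k * k by rewrite starM sk.
exists m; apply/eqP; rewrite -subr_eq0; apply/eqP; apply: psd_anti.
  apply: (@psd_closed _ (h * h)) => [|e e0]; first by rewrite starB saZ skk.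
  have [s [s0 ps] ms] := sup_adherent e0 hs.
  have -> : k * k - m%:C *: (h * h) + e%:C *: (h * h) =
      k * k - s%:C *: (h * h) + (s - m + e)%:C *: (h * h).
    by rewrite rmorphD rmorphB scalerDl scalerBl; ncring.
  apply: psdD => //; apply: psdZ; last exact: psd_sq.
  by move: ms; rewrite -/m; lra.
rewrite opprB; apply: (@psd_closed _ (h * h)) => [|e e0]; first by rewrite starB saZ skk.
have me0 : 0 <= m + e / 2 by lra.
have me : m + e / 2 < m + e by lra.
(* The first alternative would put [m + e / 2] into [S], above its supremum. *)
have [ps|pt] := sqr_dichotomy me0 me.
  have : m + e / 2 <= m by apply: ub_le_sup; [case: hs | split=> //; lra].
  by lra.
by move: pt; rewrite rmorphD scalerDl addrAC.
Qed.

End SelfAdjointPair.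

(* If the squares of both [k] and [k + h] are multiples of [h * h],
   then so is [k * h]. *)
Lemma sa_proportional h k : star h = h -> star k = k -> h <> 0 ->
  (forall a, k * a * h = h * a * k) -> exists m : R, k = m%:C *: h.
Proof.
move=> sh sk h0 khhk.
have [m km] := sqr_proportional sh sk h0 khhk.
have [||m' km'] := @sqr_proportional h (k + h) sh _ h0.
- by rewrite starD sk sh.
- by move=> a; rewrite !mulrDl mulrDr khhk.
have kh : k * h = h * k by have := khhk 1; rewrite !mulr1.
(* As [k] and [h] commute, [(k + h)^2 = k^2 + 2 k h + h^2]; solve for [k h]. *)
pose n := (m' - m - 1) / 2.
have khn : k * h = n%:C *: (h * h).
  apply: addrr_inj; rewrite -scalerDl -rmorphD /n -splitr.
  rewrite !rmorphB rmorph1 !scalerBl scale1r -km' -km.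
  by rewrite mulrDr !mulrDl -kh; ncring.
exists n; apply/eqP; rewrite -subr_eq0; apply/eqP; set d := k - _.
have dh : d * h = 0 by rewrite mulrBl khn -scalerAl subrr.
have [//|d0] := eqVneq d 0; case: h0; apply: star_mul_eq0; rewrite sh.
apply: (@prime_eq0 d) => [|a]; first exact/eqP.
have da : d * a * h = h * a * d.
  by rewrite /d !mulrBl mulrBr -!(scalerAl, scalerAr) khhk.
by rewrite mulrA da -mulrA dh mulr0.
Qed.

Lemma proportional (y z : A) : y <> 0 -> (forall a, z * a * y = y * a * z) ->
  exists c : R[i], z = c *: y.
Proof.
move=> y0 zy; pose h := star y * y; pose n := star y * z.
have sh : star h = h by rewrite starM starK.
have h0 : h <> 0 by move/star_mul_eq0.
have nh a : n * a * h = h * a * n.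
  by rewrite /n /h -!mulrA; congr (_ * _); rewrite !mulrA -(mulrA z) zy !mulrA.
have snh a : star n * a * h = h * a * star n.
  have := congr1 star (nh (star a)).
  by rewrite !(starM _ h, starM _ n, starM n, starM h) sh starK !mulrA => ->.
have [||m1 k1] := @sa_proportional h (n + star n) sh _ h0.
- by rewrite starD starK addrC.
- by move=> a; rewrite !mulrDl mulrDr nh snh.
have [||m2 k2] := @sa_proportional h ('i *: (n - star n)) sh _ h0.
- by rewrite starZi starB starK -scalerN opprB.
- by move=> a; rewrite -!(scalerAl, scalerAr) !mulrBl mulrBr nh snh.
(* [n] is recovered from [n + star n = m1 h] and [i (n - star n) = m2 h]. *)
pose c : R[i] := (2^-1)%:C * (m1%:C - 'i * m2%:C).
have nc : n = c *: h.
  rewrite -[n]sc_half /c -scalerA scalerBl -scalerA -k1 -k2 scaleii.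
  by congr (_ *: _); ncring.
exists c; apply/eqP; rewrite -subr_eq0; apply/eqP; set d := z - _.
(* The error [d] inherits the exchange relation, so [h * a * d = star y * d * a * y = 0] for all
   [a]. *)
have yd : star y * d = 0 by rewrite mulrBr -scalerAr -/n -/h nc subrr.
have dy a : d * a * y = y * a * d.
  by rewrite /d !mulrBl mulrBr -!(scalerAl, scalerAr) zy.
apply: (prime_eq0 h0) => a.
by rewrite /h -!mulrA (mulrA y) -dy !mulrA yd !mul0r.
Qed.

Lemma conj_eq_phase (y z : A) : (forall a, z * a * star z = y * a * star y) ->
  exists2 c : R[i], `|c| = 1 & z = c *: y.
Proof.
move=> zy; have := zy 1; rewrite !mulr1 => zz.
have [y0|/eqP y0] := eqVneq y 0.
  exists 1; rewrite ?normr1 // y0 scaler0; apply: mul_star_eq0.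
  by rewrite zz y0 mul0r.
have z0 : star z <> 0.
  move=> z0; apply: y0; apply: mul_star_eq0.
  by rewrite -zz z0 mulr0.
have [a|c zE] := @proportional y z y0.
  apply/eqP; rewrite -subr_eq0; apply/eqP.
  case: (Aprime (a := z * a * y - y * a * z) (b := star z)) => // [b].
  rewrite !mulrBl; apply/eqP; rewrite subr_eq0; apply/eqP.
  have -> : z * a * y * b * star z = z * (a * y * b) * star z by rewrite !mulrA.
  by rewrite zy -!mulrA !(mulrA z) zy !mulrA.
exists c => //; have : (`|c| ^+ 2 - 1) *: (y * star y) = 0.
  rewrite scalerBl scale1r -[y * star y in X in _ - X]zz zE starZ.
  by rewrite -scalerAl -scalerAr scalerA -normCK subrr.
move/eqP; rewrite scaler_eq0 subr_eq0 => /orP[/eqP c1|/eqP /mul_star_eq0 //].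
by apply/eqP; rewrite -(@pexpr_eq1 _ _ 2) // c1.
Qed.

End Prime.

(** * Polarisation and the form of [phi] *)

Lemma eq0_of_star_mul (f : A -> A) : (forall x y, f (x + y) = f x + f y) ->
  (forall x, f ('i *: x) = 'i *: f x) -> (forall x, f (star x * x) = 0) ->
  forall x, f x = 0.
Proof.
move=> fD fZ fss.
have f1 : f 1 = 0 by have := fss 1; rewrite star1 mulr1.
(* Expand [f] at [star (1 + x) * (1 + x)]; the same relation at [i x] will give
   [f x = f (star x)]. *)
have fsum x : f x + f (star x) = 0.
  have := fss (1 + x); rewrite starD star1.
  have -> : (1 + star x) * (1 + x) = 1 + star x * x + (x + star x) by ncring.
  by rewrite !fD f1 fss !add0r.
have fN x : f (- x) = - f x by rewrite -scaleii !fZ scaleii.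
move=> x; have := fsum ('i *: x); rewrite starZi fN !fZ -scalerBr => /eqP.
rewrite scaler_eq0 subr_eq0 => /orP[|/eqP fx].
  by rewrite eq_complex /= oner_eq0 andbF.
by apply: addrr_inj; rewrite addr0 {2}fx fsum.
Qed.

Lemma psd_sqr_eq1 u : psd u -> u * u = 1 -> u = 1.
Proof.
move=> /psd_positive[_ /(_ (-1))].
rewrite oppr_ge0 ler10 scaleN1r opprK => /(_ isT) u1 uu.
by apply: (mulIr u1); rewrite mulrDr uu mulr1 mul1r addrC.
Qed.

Section Wigner.
Hypothesis Aprime : prime_ring A.
Variable phi : A -> A.
Hypothesis phi_surj : forall y, exists x, phi x = y.
Hypothesis phi_cabs : forall x y,
  cabs star (phi x * star (phi y)) = cabs star (x * star y).

Lemma phi_sqr x y : phi y * star (phi x) * (phi x * star (phi y)) =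
  y * star x * (x * star y).
Proof.
have := congr1 (fun s => s * s) (phi_cabs x y).
by rewrite !cabs_sqr !starM !starK.
Qed.

Lemma phi_eq_star_mul T x : phi T = 1 -> star (phi x) * phi x = T * (star x * x) * star T.
Proof.
by move=> pT; have := phi_sqr x T; rewrite pT star1 mul1r mulr1 !mulrA.
Qed.

(** [T * star T] is positive with square 1. For [p = 1 - star T * T], [p * star T = 0] yields
    [phi p = 0], and then [phi_sqr] at [p] gives [p^4 = 0]. *)
Lemma phi_eq1_unitary T : phi T = 1 -> unitary star T.
Proof.
move=> pT.
have TT : T * star T = 1.
  apply: psd_sqr_eq1; first by rewrite -{1}(starK T); exact: psd_star_mul.
  by have := phi_sqr T T; rewrite pT star1 !mulr1.
split=> //; apply/eqP; rewrite eq_sym -subr_eq0; apply/eqP; set p := 1 - _.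
have pT0 : p * star T = 0 by rewrite mulrBl mul1r -mulrA TT mulr1 subrr.
have php : phi p = 0.
  apply: star_mul_eq0; rewrite (phi_eq_star_mul _ pT).
  by rewrite -!mulrA pT0 !mulr0.
have sp : star p = p by rewrite starB star1 starM starK.
have := phi_sqr p p; rewrite php !mul0r !sp => pp.
by apply: star_mul_eq0; rewrite sp; apply: star_mul_eq0; rewrite (starM p) sp -pp.
Qed.

(** Both sides are linear in [a], so [a = star b * b] suffices; there [T a T^*] is
    [star (phi b) * phi b], and [phi_sqr] applies. *)
Lemma phi_conj T x a : phi T = 1 ->
  phi x * T * a * star (phi x * T) = x * a * star x.
Proof.
move=> pT; apply/eqP; rewrite -subr_eq0; apply/eqP.
pose f b := phi x * T * b * star (phi x * T) - x * b * star x.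
apply: (@eq0_of_star_mul f); rewrite /f.
- by move=> b c; rewrite !mulrDr !mulrDl opprD addrACA.
- by move=> b; rewrite -!(scalerAl, scalerAr) scalerBr.
move=> b; apply/eqP; rewrite subr_eq0; apply/eqP.
have := phi_sqr b x; rewrite mulrA -(mulrA _ (star _)) (phi_eq_star_mul _ pT).
by rewrite !starM !mulrA.
Qed.

Lemma phi_phase : exists U : A, unitary star U /\
  exists f : A -> R[i], (forall x, `|f x| = 1) /\ (forall x, phi x = f x *: (x * U)).
Proof.
have [T pT] := phi_surj 1; have [sTT TsT] := phi_eq1_unitary pT.
exists (star T); split; first by split; rewrite starK.
have /choice[f fP] x : exists c : R[i], `|c| = 1 /\ phi x = c *: (x * star T).
  have [|c c1 xc] := @conj_eq_phase Aprime x (phi x * T).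
    by move=> a; exact: phi_conj.
  by exists c; split=> //; rewrite scalerAl -xc -mulrA TsT mulr1.
by exists f; split=> x; case: (fP x).
Qed.

End Wigner.

End CStarTheory.

Theorem theorem2 (R : realType) (A : unitAlgType R[i]) (star : A -> A)
    (nrm : A -> R) :
  is_unital_Cstar_algebra star nrm ->
  prime_ring A ->
  forall phi : A -> A,
    (forall y : A, exists x : A, phi x = y) ->
    (forall X Y : A,
       cabs star (phi X * star (phi Y)) = cabs star (X * star Y)) ->
    exists U : A, unitary star U /\
      exists varphi : A -> R[i], (forall X, `|varphi X| = 1) /\
        (forall X, phi X = varphi X *: (X * U)).
Proof. by move=> HA Aprime phi phi_surj phi_cabs; exact: (phi_phase HA). Qed.
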